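(* Let $F\subseteq\mathbb{R}^n$, $f\colon\mathbb{R}^n\to\mathbb{R}$, let $(\mathcal{C},\mathcal{D},g,z,\mathcal{T},\epsilon)$ be an $(F,f)$-valid configuration, and let $C\subseteq\mathbb{R}^n$. Suppose there exists a map $\omega\colon\mathbb{R}^n\to\mathbb{R}^n$ such that for all $x\in\mathbb{R}^n$: if $x\in\bigcap(\mathcal{C}\cup\mathcal{D})$ and $x\notin C$, then $$\omega(x)\in\bigcap(\mathcal{C}\cup\mathcal{D}\cup\{C\}),\qquad \omega(x)\succeq_{\epsilon,\mathcal{T}}x,\qquad g(\omega(x))\le g(x).$$ Then $(\mathcal{C},\mathcal{D}\cup\{C\},g,z,\mathcal{T},\epsilon)$ is also $(F,f)$-valid.
   Context: Constraints are arbitrary subsets of $\mathbb{R}^n$. For $\mathcal{C}\subseteq\mathcal{P}(\mathbb{R}^n)$ (power set) write $\bigcap\mathcal{C}=\bigcap_{C\in\mathcal{C}}C$, with $\bigcap\emptyset=\mathbb{R}^n$. For a list $\tau=(i_1,\dots,i_k)\in\{\pm1,\dots,\pm n\}^k$ write $\tau(x)=(\mathrm{sgn}(i_1)x_{|i_1|},\dots,\mathrm{sgn}(i_k)x_{|i_k|})\in\mathbb{R}^k$ for $x\in\mathbb{R}^n$ and $\tau(C)=\{\tau(x):x\in C\}$ for $C\subseteq\mathbb{R}^n$; the empty list is allowed. For another list $\tau'=(i'_1,\dots,i'_{k'})$, write $\tau\trianglelefteq\tau'$ if $k\le k'$ and $i_j=i'_j$ for all $1\le j\le k$. For a node $v$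 of a directed graph, $\delta^+(v)$ is its set of children. Branching tree: a tuple $\mathcal{T}=(V,E,B,\sigma)$ is a $\mathcal{C}$-consistent branching tree if: (T1) $(V,E)$ is an arborescence with $1\le|V|<\infty$ and root $r\in V$. (T2) Each $v\in V$ has a branching constraint $B_v\subseteq\mathbb{R}^n$, and $B_r=\mathbb{R}^n$. (T3) For all $u\in V$ with $\delta^+(u)\ne\emptyset$: $\bigcap\mathcal{C}\subseteq\bigcup_{v\in\delta^+(u)}B_v$. (T4) Each $v\in V$ has a list $\sigma_v\in\{\pm1,\dots,\pm n\}^{\ell_v}$, $\ell_v\in\{0,\dots,n\}$, with $|(\sigma_v)_1|,\dots,|(\sigma_v)_{\ell_v}|$ pairwise distinct. (T5) $\sigma_u\trianglelefteq\sigma_v$ for all $u\in V$, $v\in\delta^+(u)$. (T6) For all $v\in V$ and $1\le i\le\ell_v$: $\max\{\sigma_v(x)_i:x\in\bigcap\mathcal{C}\}<\infty$ (i.e. the set is bounded above). (T7) For all $u\in V$ and $v\ne w$ in $\delta^+(u)$: $\sigma_u(B_v)\cap\sigma_u(B_w)=\emptyset$. Relations: for $v\in V$ let $\mathcal{B}_v=\{B_u: u \text{ is a node on the } r\text{-}v\text{-path in } \mathcal{T}\}$. For $x,y\in\bigcap\mathcal{C}$ let $\mathrm{dcn}(x,y)$ be the deepest node $w\in V$ with $x,y\in\bigcap(\mathcal{C}\cup\mathcal{B}_w)$. For $\epsilon>0$ and $a,b\in\mathbb{R}^k$, let $a\succ_\epsilon b$ mean $a\neq b$ and $a_i\ge b_i+\epsilon$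 for the smallest index $i$ with $a_i\ne b_i$. For $x,y\in\bigcap\mathcal{C}$ and $v=\mathrm{dcn}(x,y)$: $x\succeq_{\epsilon,\mathcal{T}}y$ iff $\sigma_v(x)=\sigma_v(y)$ or $\sigma_v(x)\succ_\epsilon\sigma_v(y)$; $x\succ_{\epsilon,\mathcal{T}}y$ iff $\sigma_v(x)\succ_\epsilon\sigma_v(y)$. Configuration: let $F\subseteq\mathbb{R}^n$, $f\colon\mathbb{R}^n\to\mathbb{R}$. A configuration $(\mathcal{C},\mathcal{D},g,z,\mathcal{T},\epsilon)$ with $\mathcal{C},\mathcal{D}\subseteq\mathcal{P}(\mathbb{R}^n)$, $g\colon\mathbb{R}^n\to\mathbb{R}$, $z\in\mathbb{R}\cup\{\infty\}$, $\mathcal{T}$ a branching tree and $\epsilon$ a real number is $(F,f)$-valid if: (V1) $\mathcal{T}$ is $\mathcal{C}$-consistent and $\epsilon>0$. (V2) If $z<\infty$, there exists $x\in F$ with $f(x)\le z$. (V3) For all real $\hat z<z$, there exists $x\in F$ with $f(x)\le\hat z$ if and only if there exists $x\in\bigcap\mathcal{C}$ with $g(x)\le\hat z$. (V4) For every $x\in\bigcap\mathcal{C}$ with $g(x)<z$ there exists $y\in\bigcap(\mathcal{C}\cup\mathcal{D})$ with $y\succeq_{\epsilon,\mathcal{T}}x$ and $g(y)\le g(x)$. *)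

(* Defs.v *)
(* R^n is 'rV[R]_n for an arbitrary R : realType. *)
From HB Require Import structures.
From mathcomp Require Import all_boot all_order all_algebra.
From mathcomp Require Import all_classical all_reals.

Set Implicit Arguments.
Unset Strict Implicit.
Unset Printing Implicit Defensive.

Import Order.TTheory GRing.Theory Num.Theory.

Local Open Scope classical_set_scope.
Local Open Scope ring_scope.

(* The index i in {±1, ..., ±n} is the pair (i < 0, |i| - 1). *)
Definition signed_index (n : nat) := (bool * 'I_n)%type.

Definition signed_proj (R : realType) (n : nat) (tau : seq (signed_index n))
    (x : 'rV[R]_n) : seq R :=
  [seq (-1) ^+ (i.1 : bool) * x ord0 i.2 | i <- tau].

Definition bigI (T : Type) (CC : set (set T)) : set T := \bigcap_(C in CC) C.

(* Only meant for lists of the same size, i.e. for two elements of some R^k. *)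
Definition succ_eps (R : realType) (eps : R) (a b : seq R) : Prop :=
  exists i : nat, [/\ (i < size a)%N,
    forall j : nat, (j < i)%N -> a`_j = b`_j,
    a`_i <> b`_i & b`_i + eps <= a`_i].

(* The root, determined by the arborescence, is kept as an explicit field. *)
Record branching_tree (R : realType) (n : nat) := BranchingTree {
  node : finType;
  edge : rel node;
  tree_root : node;
  bconstr : node -> set 'rV[R]_n;
  sigma : node -> seq (signed_index n)
}.

Section Tree.
Context {R : realType} {n : nat}.
Implicit Types (T : branching_tree R n) (CC : set (set 'rV[R]_n)).

(* Walks are sequences of nodes with the starting node left out, so that the
   trivial walk from the root to itself is the empty sequence. *)
Definition root_walk T (v : node T) : set (seq (node T)) :=
  [set p | path (@edge R n T) (tree_root T) p /\ last (tree_root T) p = v].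

Definition arborescence T : Prop :=
  forall v : node T, exists! p, root_walk v p.

Definition root_path T (v : node T) : seq (node T) :=
  xget [::] (root_walk v).

Definition depth T (v : node T) : nat := size (root_path v).

Definition children T (u : node T) : set (node T) := [set v | edge u v].

Definition path_constrs T (v : node T) : set (set 'rV[R]_n) :=
  [set bconstr u | u in [set u | u \in tree_root T :: root_path v]].

Record consistent CC T : Prop := Consistent {
  consistent_arborescence : arborescence T;
  consistent_root : bconstr (tree_root T) = setT;
  consistent_cover : forall u : node T, children u !=set0 ->
    bigI CC `<=` \bigcup_(v in children u) bconstr v;
  consistent_size : forall v : node T, (size (sigma v) <= n)%N;
  consistent_uniq : forall v : node T, uniq [seq i.2 | i <- sigma v];
  consistent_prefix : forall u v : node T,
    children u v -> prefix (sigma u) (sigma v);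
  consistent_bounded : forall (v : node T) (i : nat),
    (i < size (sigma v))%N ->
    has_ubound [set (signed_proj (sigma v) x)`_i | x in bigI CC];
  consistent_disjoint : forall u v w : node T,
    children u v -> children u w -> v <> w ->
    (signed_proj (sigma u) @` bconstr v) `&`
      (signed_proj (sigma u) @` bconstr w) = set0
}.

(* For x, y in bigI CC and a CC-consistent T, the root is a candidate and the
   candidates form a path starting there, so the maximiser is unique.  For
   other x, y the value is junk. *)
Definition dcn CC T (x y : 'rV[R]_n) : node T :=
  [arg max_(w > tree_root T |
    `[< bigI (CC `|` path_constrs w) x /\ bigI (CC `|` path_constrs w) y >])
    depth w]%N.

Definition succeq CC (eps : R) T (x y : 'rV[R]_n) : Prop :=
  let s := sigma (dcn CC T x y) in
  signed_proj s x = signed_proj s y \/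
  succ_eps eps (signed_proj s x) (signed_proj s y).

(* Only meant for z in R or z = +oo; z = -oo is not excluded here. *)
Record valid (F : set 'rV[R]_n) (f : 'rV[R]_n -> R)
    CC (DD : set (set 'rV[R]_n)) (g : 'rV[R]_n -> R) (z : \bar R) T (eps : R)
    : Prop := Valid {
  valid_tree : consistent CC T;
  valid_eps : 0 < eps;
  valid_attained : (z < +oo)%E -> exists2 x, F x & ((f x)%:E <= z)%E;
  valid_equiv : forall zh : R, (zh%:E < z)%E ->
    (exists2 x, F x & f x <= zh) <-> (exists2 x, bigI CC x & g x <= zh);
  valid_dominance : forall x, bigI CC x -> ((g x)%:E < z)%E ->
    exists y, [/\ bigI (CC `|` DD) y, succeq CC eps T y x & g y <= g x]
}.

End Tree.

(* Main.v *)
Require Import Defs.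
From mathcomp Require Import all_boot all_order all_algebra.
From mathcomp Require Import all_classical all_reals.

Set Implicit Arguments.
Unset Strict Implicit.
Unset Printing Implicit Defensive.

Import Order.TTheory GRing.Theory Num.Theory.

Local Open Scope classical_set_scope.
Local Open Scope ring_scope.

(** Only the dominance condition mentions the set of dominance constraints.
    Given [x], it provides a dominating [y] for the old constraints, and if [y]
    violates [C] then [omega y] satisfies everything and dominates [y].  It then
    dominates [x] as well, provided [succeq] is transitive on the feasible set
    [bigI CC].  This is not formal, since the three comparisons involved may be
    made with the lists of different nodes of the tree.

    To compare [x] and [z] knowing that [x] dominates [y] and [y] dominates [z],
    identify nodes with walks from the root, and say that a point follows a walk
    if it satisfies all constraints along it.  Sibling constraints are
    disjoint, so the walks followed by one point form a chain; hence
    [dcn x y] is the end of a walk that extends every walk followed by both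
    [x] and [y] ([follows_prefix_dcn]).  As lists only grow along walks, the
    comparison made at [dcn x y] remains true, possibly with equality, at every
    earlier node ([succeq_follows]).

    Let [c] be the walk to [dcn x z].  If [y] follows [c], then both hypotheses
    restrict to the end of [c], where the lexicographic comparison is
    transitive.  Otherwise [y] leaves [c] at some node [u], and the
    hypotheses can be compared at [u].  If [x] is strictly above [z] there, it
    stays so for the longer list at the end of [c].  If they agree on the list
    of [u], then [y] agrees with them too; but [y] lies in a child of [u]
    other than the one followed by [x], and the images of distinct children
    under the list of [u] are disjoint: a contradiction. *)

(** * The lexicographic comparison with a gap *)

Lemma succ_eps_irrefl (R : realType) (eps : R) (a : seq R) :
  ~ succ_eps eps a a.
Proof. by case=> i [_ _]. Qed.

Lemma succ_eps_trans (R : realType) (eps : R) (a b c : seq R) :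
  0 < eps -> size a = size b ->
  succ_eps eps a b -> succ_eps eps b c -> succ_eps eps a c.
Proof.
move=> e0 sab [i [ia abi nabi leab]] [j [jb bcj nbcj lebc]].
(* When both first differences occur at the same index, the gaps add up, and
   positivity of [eps] keeps the outer entries distinct. *)
have gtgap (u v : R) : v + eps <= u -> u <> v.
  by move=> le_vu uv; move: le_vu; rewrite uv gerDl leNgt e0.
case: (ltngtP i j) => [ij|ji|ij].
- exists i; split=> // [k ki||]; last by rewrite -bcj.
    by rewrite abi // bcj // (ltn_trans ki).
  by rewrite -bcj.
- exists j; rewrite sab abi //; split=> // k kj.
  by rewrite abi ?bcj // (ltn_trans kj).
- subst j; have leac : c`_i + eps <= a`_i.
    by apply: le_trans lebc (le_trans _ leab); rewrite lerDl ltW.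
  exists i; split=> // [k ki|]; first by rewrite abi // bcj.
  exact: gtgap.
Qed.

Lemma succ_eps_cat (R : realType) (eps : R) (a b a' b' : seq R) :
  size a = size b ->
  succ_eps eps a b -> succ_eps eps (a ++ a') (b ++ b').
Proof.
move=> sab [i [ia abi nab leab]]; exists i.
rewrite !nth_cat -sab ia size_cat; split=> // [|j ji].
  exact: ltn_addr.
by rewrite !nth_cat -sab (ltn_trans ji ia) abi.
Qed.

(** The first difference of the long lists may lie beyond the short ones, in
    which case the latter agree. *)
Lemma succ_eps_catl (R : realType) (eps : R) (a b a' b' : seq R) :
  size a = size b ->
  succ_eps eps (a ++ a') (b ++ b') -> a = b \/ succ_eps eps a b.
Proof.
move=> sab [i [_ abi nab leab]]; case: (ltnP i (size a)) => ia.
  right; exists i; move: nab leab; rewrite !nth_cat -sab ia; split=> // j ji.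
  by have := abi j ji; rewrite !nth_cat -sab (ltn_trans ji ia).
left; apply: (@eq_from_nth _ 0) => // j ja.
by have := abi j (leq_trans ja ia); rewrite !nth_cat -sab ja.
Qed.

Definition lex_succeq (R : realType) (n : nat) (eps : R)
    (s : seq (signed_index n)) (x y : 'rV[R]_n) : Prop :=
  signed_proj s x = signed_proj s y \/
  succ_eps eps (signed_proj s x) (signed_proj s y).

Lemma size_signed_proj (R : realType) (n : nat) (s : seq (signed_index n))
    (x y : 'rV[R]_n) :
  size (signed_proj s x) = size (signed_proj s y).
Proof. by rewrite !size_map. Qed.

Lemma lex_succeq_trans (R : realType) (n : nat) (eps : R)
    (s : seq (signed_index n)) (x y z : 'rV[R]_n) :
  0 < eps -> lex_succeq eps s x y -> lex_succeq eps s y z ->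
  lex_succeq eps s x z.
Proof.
rewrite /lex_succeq => e0 [->//|xy] [<-|yz]; right=> //.
exact: succ_eps_trans (size_signed_proj s x y) xy yz.
Qed.

(** A strict step from [x] to [y] would survive composition with the step from
    [y] to [z], so agreement of the endpoints forces agreement throughout. *)
Lemma lex_succeq_anti (R : realType) (n : nat) (eps : R)
    (s : seq (signed_index n)) (x y z : 'rV[R]_n) :
  0 < eps -> lex_succeq eps s x y -> lex_succeq eps s y z ->
  signed_proj s x = signed_proj s z -> signed_proj s x = signed_proj s y.
Proof.
move=> e0 [//|xy] [yz|yz] xz; first by rewrite yz.
have := succ_eps_trans e0 (size_signed_proj s x y) xy yz.
by rewrite xz => /succ_eps_irrefl.
Qed.

Lemma lex_succeq_prefix (R : realType) (n : nat) (eps : R)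
    (s t : seq (signed_index n)) (x y : 'rV[R]_n) :
  prefix s t -> lex_succeq eps t x y -> lex_succeq eps s x y.
Proof.
move=> /prefixP[t' ->]; rewrite /lex_succeq /signed_proj !map_cat => -[/eqP|].
  by rewrite eqseq_cat ?size_map// => /andP[/eqP]; left.
by apply: succ_eps_catl; rewrite !size_map.
Qed.

(** * Walks followed by a point *)

Definition follows (R : realType) (n : nat) (T : branching_tree R n)
    (x : 'rV[R]_n) (p : seq (node T)) : Prop :=
  forall u, u \in p -> bconstr u x.

Lemma prefix_sigma_path (R : realType) (n : nat) (CC : set (set 'rV[R]_n))
    (T : branching_tree R n) (u : node T) (p : seq (node T)) :
  consistent CC T -> path (@edge R n T) u p ->
  prefix (sigma u) (sigma (last u p)).
Proof.
move=> hT; elim: p u => [|v p IH] u /=; first by rewrite prefix_refl.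
case/andP=> uv vp; apply: prefix_trans (IH v vp).
exact: (consistent_prefix hT uv).
Qed.

(** At each node at most one child constraint contains [x], by disjointness of
    the projections of sibling constraints. *)
Lemma follows_chain (R : realType) (n : nat) (CC : set (set 'rV[R]_n))
    (T : branching_tree R n) (x : 'rV[R]_n) (u : node T)
    (p q : seq (node T)) :
  consistent CC T -> path (@edge R n T) u p -> path (@edge R n T) u q ->
  follows x p -> follows x q -> prefix p q \/ prefix q p.
Proof.
move=> hT; elim: p u q => [|v p IH] u q.
  by left; rewrite prefix0s.
case: q => [|w q]; first by right.
move=> /= /andP[uv vp] /andP[uw wq] xp xq.
have vw : v = w.
  apply: contrapT => vw.
  have := consistent_disjoint hT uv uw vw.
  move=> /seteqP[/(_ (signed_proj (sigma u) x))]; case.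
  by split; exists x => //; [apply: xp|apply: xq]; rewrite mem_head.
rewrite vw eqxx /=; apply: IH (vp) _ _ _; rewrite ?vw //.
  by move=> t tp; apply: xp; rewrite inE tp orbT.
by move=> t tp; apply: xq; rewrite inE tp orbT.
Qed.

(** Cutting [p] at the first constraint violated by [x] isolates the node whose
    children tell [x] apart from the points that follow all of [p]. *)
Lemma follows_or_leaves (R : realType) (n : nat) (T : branching_tree R n)
    (x : 'rV[R]_n) (p : seq (node T)) :
  follows x p \/
  exists m v q, [/\ p = m ++ v :: q, follows x m & ~ bconstr v x].
Proof.
elim: p => [|v p IH]; first by left.
case: (pselect (bconstr v x)) => [xv|nxv]; last by right; exists [::], v, p.
case: IH => [xp|[m [w [q [-> xm nxw]]]]].
  by left=> u; rewrite inE => /predU1P[->//|]; apply: xp.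
right; exists (v :: m), w, q; split=> // u.
by rewrite inE => /predU1P[->//|]; apply: xm.
Qed.

Lemma root_pathP (R : realType) (n : nat) (T : branching_tree R n)
    (v : node T) :
  arborescence T -> root_walk v (root_path v).
Proof. by move=> /(_ v)[p [vp _]]; apply: xgetPex; exists p. Qed.

Lemma root_path_last (R : realType) (n : nat) (T : branching_tree R n)
    (p : seq (node T)) :
  arborescence T -> path (@edge R n T) (tree_root T) p ->
  root_path (last (tree_root T) p) = p.
Proof.
move=> hT rp; have [q [_ qE]] := hT (last (tree_root T) p).
exact: etrans (esym (qE _ (root_pathP _ hT))) (qE p (conj rp erefl)).
Qed.

Lemma path_constrsP (R : realType) (n : nat) (CC : set (set 'rV[R]_n))
    (T : branching_tree R n) (x : 'rV[R]_n) (w : node T) :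
  consistent CC T -> bigI CC x ->
  bigI (CC `|` path_constrs w) x <-> follows x (root_path w).
Proof.
move=> hT xCC; split=> [xw u uw|xw D [/xCC//|[u /= + <-]]].
  by apply: xw; right; exists u => //=; rewrite inE uw orbT.
by rewrite inE => /predU1P[->|/xw//]; rewrite (consistent_root hT).
Qed.

(** * Walks to the deepest common node *)

(** The root is a candidate, so the maximum defining [dcn] is a genuine one. *)
Lemma dcnP (R : realType) (n : nat) (CC : set (set 'rV[R]_n))
    (T : branching_tree R n) (x y : 'rV[R]_n) :
  consistent CC T -> bigI CC x -> bigI CC y ->
  let w := dcn CC T x y in
  [/\ follows x (root_path w), follows y (root_path w) &
    forall v : node T, follows x (root_path v) -> follows y (root_path v) ->
      (depth v <= depth w)%N].
Proof.
move=> hT xCC yCC; rewrite /dcn; case: arg_maxnP => [|w /asboolP[xw yw] wmax].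
  have root0 := @root_path_last _ _ T [::] (consistent_arborescence hT) isT.
  by apply/asboolP; split; apply/path_constrsP => //; rewrite root0.
split; [exact/(path_constrsP w hT xCC)|exact/(path_constrsP w hT yCC)|].
move=> v xv yv.
by apply: wmax; apply/asboolP; split; apply/path_constrsP.
Qed.

(** Both walks are followed by [x], so one extends the other, and the one to
    the deepest common node is the longer one. *)
Lemma follows_prefix_dcn (R : realType) (n : nat) (CC : set (set 'rV[R]_n))
    (T : branching_tree R n) (x y : 'rV[R]_n) (p : seq (node T)) :
  consistent CC T -> bigI CC x -> bigI CC y ->
  path (@edge R n T) (tree_root T) p -> follows x p -> follows y p ->
  prefix p (root_path (dcn CC T x y)).
Proof.
move=> hT xCC yCC rp xp yp; have harb := consistent_arborescence hT.
have [xw yw wmax] := dcnP hT xCC yCC.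
have [rw _] := root_pathP (dcn CC T x y) harb.
have [//|wp] := follows_chain hT rp rw xp xw.
have := wmax (last (tree_root T) p); rewrite /depth root_path_last//.
move=> /(_ xp yp) pw; move/prefixP: wp pw => [q ->].
rewrite size_cat -{2}[size _]addn0 leq_add2l leqn0.
by move=> /nilP->; rewrite cats0 prefix_refl.
Qed.

(** This brings comparisons made at different nodes to a common one: a common
    walk ends at or above the deepest common node, where the list is an initial
    segment, and truncation turns a strict comparison into a weak one. *)
Lemma succeq_follows (R : realType) (n : nat) (CC : set (set 'rV[R]_n))
    (T : branching_tree R n) (eps : R) (x y : 'rV[R]_n) (p : seq (node T)) :
  consistent CC T -> bigI CC x -> bigI CC y -> succeq CC eps T x y ->
  path (@edge R n T) (tree_root T) p -> follows x p -> follows y p ->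
  lex_succeq eps (sigma (last (tree_root T) p)) x y.
Proof.
move=> hT xCC yCC xy rp xp yp; apply: lex_succeq_prefix xy.
have [rw <-] := root_pathP (dcn CC T x y) (consistent_arborescence hT).
have /prefixP[q wE] := follows_prefix_dcn hT xCC yCC rp xp yp.
move: rw; rewrite wE cat_path last_cat => /andP[_ pq].
exact: prefix_sigma_path hT pq.
Qed.

(** * Transitivity *)

(** Either [y] stays in the deepest common node of [x] and [z], or it leaves the
    common walk at a node [u]; there the covering condition puts [y] in a
    sibling branch, and disjointness forces the comparison to be strict
    already at [u]. *)
Lemma succeq_trans (R : realType) (n : nat) (CC : set (set 'rV[R]_n))
    (T : branching_tree R n) (eps : R) (x y z : 'rV[R]_n) :
  consistent CC T -> 0 < eps -> bigI CC x -> bigI CC y -> bigI CC z ->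
  succeq CC eps T x y -> succeq CC eps T y z -> succeq CC eps T x z.
Proof.
move=> hT e0 xCC yCC zCC xy yz.
have [xc zc _] := dcnP hT xCC zCC.
have [rc cE] := root_pathP (dcn CC T x z) (consistent_arborescence hT).
change (lex_succeq eps (sigma (dcn CC T x z)) x z).
rewrite -cE; move: (root_path _) rc xc zc => c rc xc zc {cE}.
have [yc|[m [v [q [cE ym nyv]]]]] := follows_or_leaves y c.
  by apply: lex_succeq_trans e0 _ _;
    [apply: succeq_follows xy _ _ _|apply: succeq_follows yz _ _ _].
have mc t : t \in m -> t \in c by rewrite cE mem_cat => ->.
have xm : follows x m by move=> t /mc/xc.
have zm : follows z m by move=> t /mc/zc.
move: (rc); rewrite cE cat_path last_cat => /andP[rm mq].
have xym := succeq_follows hT xCC yCC xy rm xm ym.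
have yzm := succeq_follows hT yCC zCC yz rm ym zm.
have /prefixP[s ->] := prefix_sigma_path hT mq.
set u := last _ m in xym yzm mq *.
have [xzu|xzu] := lex_succeq_trans e0 xym yzm; last first.
  right; rewrite /signed_proj !map_cat.
  exact: succ_eps_cat (size_signed_proj _ _ _) xzu.
have xyu := lex_succeq_anti e0 xym yzm xzu.
(* By covering, [y] lies in a child [w] of [u], and [w] differs from [v]. *)
have uv : children u v by case/andP: mq.
have [w uw yw] := consistent_cover hT (ex_intro _ v uv) yCC.
have vw : v <> w by move=> vw; apply: nyv; rewrite vw.
have /seteqP[/(_ (signed_proj (sigma u) x))] := consistent_disjoint hT uv uw vw.
case; split; last by exists y.
by exists x => //; apply: xc; rewrite cE mem_cat mem_head orbT.
Qed.

Lemma bigIU (U : Type) (AA BB : set (set U)) (x : U) :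
  bigI (AA `|` BB) x <-> bigI AA x /\ bigI BB x.
Proof. by rewrite /bigI bigcap_setU. Qed.

Theorem theorem6 (R : realType) (n : nat)
    (F : set 'rV[R]_n) (f : 'rV[R]_n -> R)
    (CC DD : set (set 'rV[R]_n)) (g : 'rV[R]_n -> R)
    (z : \bar R) (hz : (-oo < z)%E)
    (T : branching_tree R n) (eps : R)
    (hvalid : valid F f CC DD g z T eps)
    (C : set 'rV[R]_n)
    (homega : exists omega : 'rV[R]_n -> 'rV[R]_n,
      forall x : 'rV[R]_n, bigI (CC `|` DD) x -> ~ C x ->
        [/\ bigI (CC `|` DD `|` [set C]) (omega x),
            succeq CC eps T (omega x) x
          & g (omega x) <= g x]) :
  valid F f CC (DD `|` [set C]) g z T eps.
Proof.
case: hvalid => hT e0 hatt hequiv hdom; split=> // x xCC gxz.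
have [y [yCD yx gyx]] := hdom x xCC gxz.
rewrite setUA; case: (pselect (C y)) => [yC|nyC].
  by exists y; split=> //; apply/bigIU; split=> // _ ->.
have [omega /(_ y yCD nyC)[oCD oy goy]] := homega.
have /bigIU[yCC _] := yCD.
have /bigIU[/bigIU[oCC _] _] := oCD.
exists (omega y); split=> //; last exact: le_trans goy gyx.
exact: succeq_trans oy yx.
Qed.
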